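(* Let $n\ge 2$ and let $V$, $B$, $\mathcal{R}$, $A$ and $\tilde R$ be as defined in the context. Then $\mathcal{R}^A=\tilde R$; that is, as linear operators $V\otimes V\to V\otimes V\otimes B$, $$A_2^{-1}A_1^{-1}\,\mathcal{R}\,A_1A_2=\tilde R .$$
   Context: $\mathbb{F}$ is an algebraically closed field of characteristic zero. Let $T$ be the maximal torus of $SL(n)$, $\mathfrak h$ its Lie algebra, $\mathbf{P}\subset\mathfrak{h}^*$ the weight lattice, $(\cdot,\cdot)$ the standard invariant bilinear form on $\mathfrak{h}^*$. $V$ is the standard representation with basis of weight vectors $e_1,\dots,e_n$ of weights $\nu_1,\dots,\nu_n\in\mathfrak h^*$, so $\sum_i\nu_i=0$ and $(\nu_i,\nu_j)=\delta_{ij}-1/n$. $H=\mathbb{F}[K_\lambda\mid\lambda\in \mathbf{P}]$ is the group algebra of $\mathbf{P}$, and $V$ is an $H$-comodule via $e_i\mapsto e_i\otimes K_{\nu_i}$. Let $B=\operatorname{Frac}(S(\mathfrak h^* ))$, the fraction field of the symmetric algebra, on which each $K_\lambda$ acts by the field automorphism $b\mapsto b^\lambda$ determined by $\nu^\lambda=\nu+(\lambda,\nu)$ for $\nu\in\mathfrak h^*$. Composition of linear operators $f:U\to W\otimes B$, $g:W\to X\otimes B$ is $(1\otimes m_B)(g\otimes 1_B)f$, i.e. $g$ is extended $B$-linearly; inverses are taken with respect to this composition. For linear $f:V\to V'\otimes B$, $g:W\to W'\otimes B$ with $V',W'$ $H$-comodules, $f\tilde\otimes g=(1\otimes m_B)(1\otimes\tau\otimes1)(f\otimes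 g):V\otimes W\to V'\otimes W'\otimes B$, where $\tau(b\otimes w)=b^\mu$-twist: $\tau(b\otimes w)=w\otimes b^{\mu}$ for $w$ of weight $\mu$. For $A:V\to V\otimes B$ set $A_1=A\tilde\otimes1$, $A_2=1\tilde\otimes A$; thus if $A(e_i)=\sum_kA^k_i$-components, $A(e_i)=\sum_k e_k\otimes A_i^k$, then $A_1(e_i\otimes e_j)=\sum_ke_k\otimes e_j\otimes(A_i^k)^{\nu_j}$ and $A_2(e_i\otimes e_j)=\sum_le_i\otimes e_l\otimes A_j^l$. For $\mathcal{R}:V\otimes V\to V\otimes V\otimes B$ and invertible $A$, put $\mathcal{R}^A=A_2^{-1}A_1^{-1}\mathcal{R}A_1A_2$. The operators in question: $A(e_i)=\sum_{k=1}^ne_k\otimes\nu_k^{i-1}$ (here $\nu_k^{i-1}$ is the $(i-1)$-st power), which is invertible; and $$\mathcal{R}(e_i\otimes e_j)=e_i\otimes e_j\otimes\frac{1}{\nu_i-\nu_j+\delta_{ij}}+e_j\otimes e_i\otimes\left(1-\frac{1}{\nu_j-\nu_i+\delta_{ij}}\right).$$ Equivalently, with $\alpha(x)=1/(x+1/n)$ and $\beta(x)=1-\alpha(x)$, $\mathcal{R}(e_i\otimes e_j)=e_i\otimes e_j\otimes\alpha(\nu_i^{\nu_j}-\nu_j)+e_j\otimes e_i\otimes\beta(\nu_j^{\nu_i}-\nu_i)$. Finally, identify $V\otimes V$ with polynomials in $z_1,z_2$ of degree less than $n$ in each variable by $e_i\otimes e_j\leftrightarrow z_1^{i-1}z_2^{j-1}$.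 Let $(Pf)(z_1,z_2)=f(z_2,z_1)$, $(\tilde F_hf)(z_1,z_2)=f(z_1+h,z_2-h)$, let $R$ be the operator $\tilde F_h-\frac{hn}{z_1-z_2+h}(\tilde F_h-P)$ with $h=1/n$ restricted to $V\otimes V$, and $\tilde R=RP$. $\tilde R$ is regarded as an operator $V\otimes V\to V\otimes V\otimes\mathbb{F}\subset V\otimes V\otimes B$. *)

(* Defs.v *)
From HB Require Import structures.
From mathcomp Require Import all_boot all_algebra.
From mathcomp Require Import fraction polyXY mxtens.
From mathcomp Require Import mpoly ring.

Set Implicit Arguments.
Unset Strict Implicit.
Unset Printing Implicit Defensive.

Import GRing.Theory.
Local Open Scope ring_scope.

Arguments mxtens_index {m n}.
Arguments mxtens_unindex {m n}.

Notation "x %:F" := (@FracField.tofrac _ x) (format "x %:F") : ring_scope.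

Section FracMap.
Variables (R S : idomainType) (f : {rmorphism R -> S}).

(* The map r / s |-> f r / f s; it is well defined, and a field morphism, as
   soon as f is injective. *)
Definition frac_map (x : {fraction R}) : {fraction S} :=
  (f \n_(repr x))%:F / (f \d_(repr x))%:F.

End FracMap.

Section FracMapTheory.
Variables (R S : idomainType) (f : {rmorphism R -> S}).
Hypothesis f_inj : injective f.

Lemma frac_numden (x : {fraction R}) : x = (\n_(repr x))%:F / (\d_(repr x))%:F.
Proof.
have d0 := denom_ratioP (repr x).
apply: (canRL (mulfK _)); first by rewrite tofrac_eq0.
rewrite -[X in X * _](reprK x); unlock FracField.tofrac.
rewrite -[LHS]FracField.pi_mul; apply/eqmodP.
rewrite /= FracField.equivfE /FracField.mulf.
by rewrite !numden_Ratio ?mulf_neq0 ?oner_neq0 // !mulr1 mulrC.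
Qed.

Lemma frac_mapE (a b : R) : b != 0 ->
  frac_map f (a%:F / b%:F) = (f a)%:F / (f b)%:F.
Proof.
move=> b0; rewrite /frac_map; set x := a%:F / b%:F.
have d0 := denom_ratioP (repr x).
have fn0 c : c != 0 -> (f c)%:F != 0 :> {fraction S}.
  by move=> c0; rewrite tofrac_eq0 (raddf_eq0 _ f_inj).
have: x = (\n_(repr x))%:F / (\d_(repr x))%:F := frac_numden x.
rewrite {1}/x => /eqP; rewrite eqr_div ?tofrac_eq0 // -!tofracM tofrac_eq.
move/eqP=> e; apply/eqP; rewrite eqr_div ?fn0 // -!tofracM tofrac_eq.
by rewrite -!rmorphM e.
Qed.

Lemma frac_map_tofrac (a : R) : frac_map f a%:F = (f a)%:F.
Proof.
by rewrite -[a%:F]divr1 -tofrac1 frac_mapE ?oner_neq0 // rmorph1 tofrac1 divr1.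
Qed.

Lemma frac_mapB : zmod_morphism (frac_map f).
Proof.
move=> x y; rewrite (frac_numden x) (frac_numden y).
set a := \n_ _; set b := \d_ _; set c := \n_ _; set d := \d_ _.
have b0 : b != 0 by apply: denom_ratioP.
have d0 : d != 0 by apply: denom_ratioP.
have fn0 e : e != 0 -> (f e)%:F != 0 :> {fraction S}.
  by move=> e0; rewrite tofrac_eq0 (raddf_eq0 _ f_inj).
rewrite -mulNr -tofracN addf_div ?tofrac_eq0 // -!tofracM -tofracD.
rewrite !frac_mapE ?mulf_neq0 // -mulNr -tofracN addf_div ?fn0 //.
by rewrite -!tofracM -tofracD !rmorphD !rmorphM rmorphN.
Qed.

Lemma frac_mapM : monoid_morphism (frac_map f).
Proof.
split=> [|x y]; first by rewrite -[1]tofrac1 frac_map_tofrac rmorph1.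
rewrite (frac_numden x) (frac_numden y).
set a := \n_ _; set b := \d_ _; set c := \n_ _; set d := \d_ _.
have b0 : b != 0 by apply: denom_ratioP.
have d0 : d != 0 by apply: denom_ratioP.
rewrite mulf_div -!tofracM !frac_mapE ?mulf_neq0 // mulf_div -!tofracM.
by rewrite !rmorphM.
Qed.

End FracMapTheory.

(* The dual of the Cartan subalgebra of SL(n), in coordinates with respect to
   the basis formed by the first n - 1 weights of the standard representation. *)
Notation hdual F n := 'rV[F]_n.-1.

(* The symmetric algebra of [hdual] is the polynomial ring on that same basis;
   B is its fraction field. *)
Notation symh F n := {mpoly F[n.-1]}.
Definition fracB (F : closedFieldType) (n : nat) : fieldType :=
  {fraction symh F n}.

Section Weights.
Variables (F : closedFieldType) (n : nat).

(* The last weight is minus the sum of the basis vectors. *)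
Definition nu (i : 'I_n) : hdual F n :=
  \row_(j < n.-1) ((i == j :> nat)%:R - (i == n.-1 :> nat)%:R).

(* Given by its Gram matrix on the basis; see [form_nu]. *)
Definition form (x y : hdual F n) : F :=
  (x *m (\matrix_(i, j) ((i == j)%:R - n%:R^-1)) *m y^T) 0 0.

Definition inS (x : hdual F n) : symh F n := \sum_j x 0 j *: 'X_j.

Definition inB (x : hdual F n) : fracB F n := (inS x)%:F.

Definition nuB (i : 'I_n) : fracB F n := inB (nu i).

(* The action of K_lam on the symmetric algebra and on B; see [twist_inB]. *)
Definition twistS (lam : hdual F n) : symh F n -> symh F n :=
  comp_mpoly [tuple 'X_j + (form lam (delta_mx 0 j))%:MP | j < n.-1].
HB.instance Definition _ lam := GRing.LRMorphism.on (twistS lam).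

Definition twist (lam : hdual F n) : fracB F n -> fracB F n :=
  frac_map (twistS lam).

End Weights.

Section WeightsTheory.
Variables (F : closedFieldType) (n : nat).

Lemma formE (x y : hdual F n) :
  form x y = \sum_j x 0 j * y 0 j
             - (\sum_j x 0 j) * (\sum_j y 0 j) / n%:R.
Proof.
rewrite /form.
have -> : \matrix_(i, j) ((i == j)%:R - n%:R^-1) =
          1%:M - const_mx n%:R^-1 :> 'M[F]_n.-1.
  by apply/matrixP=> a b; rewrite !mxE.
rewrite mulmxBr mulmxBl mulmx1 !mxE; congr (_ - _).
  by apply: eq_bigr => j _; rewrite mxE.
rewrite mulrAC mulr_sumr; apply: eq_bigr => b _; rewrite !mxE; congr (_ * _).
by rewrite mulr_suml; apply: eq_bigr => a _; rewrite mxE.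
Qed.

Lemma sum_row_nu (i : 'I_n) :
  \sum_j nu F i 0 j = 1 - n%:R * (i == n.-1 :> nat)%:R.
Proof.
case: n i => [[]//|m] i /=; under eq_bigr do rewrite mxE.
rewrite sumrB sumr_const card_ord -mulr_natl.
suff -> : \sum_(j < m) (i == j :> nat)%:R = 1 - (i == m :> nat)%:R :> F.
  by rewrite -natr1; ring.
have [im|im] := eqVneq (i : nat) m.
  rewrite subrr big1 // => j _; case: eqP => //= ij.
  by have := ltn_ord j; rewrite -ij im ltnn.
have lim : (i < m)%N by rewrite ltn_neqAle im -ltnS ltn_ord.
rewrite subr0 (bigD1 (Ordinal lim)) //= eqxx big1 ?addr0 // => j ji.
by case: eqP => // ij; case/eqP: ji; apply: val_inj.
Qed.

Lemma form_nu (i j : 'I_n) : n%:R != 0 :> F ->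
  form (nu F i) (nu F j) = (i == j)%:R - n%:R^-1.
Proof.
move=> n0; rewrite formE !sum_row_nu.
under eq_bigr do rewrite [nu F j _ _]mxE mulrBr.
rewrite sumrB -mulr_suml sum_row_nu.
set p : F := (i == _ :> nat)%:R; set q : F := (j == _ :> nat)%:R.
have -> : \sum_(a < n.-1) nu F i 0 a * (j == a :> nat)%:R =
          (i == j)%:R - p * q - p * (1 - q) :> F; last by field.
rewrite {}/p {}/q; case: n i j {n0} => [[]//|m] i j /=.
have [jm|jm] := eqVneq (j : nat) m.
  rewrite big1 => [|a _]; last first.
    case: eqP => [ja|_]; last by rewrite mulr0.
    by have := ltn_ord a; rewrite -ja jm ltnn.
  by rewrite -[i == j]/(i == j :> nat) jm mulr1 !subrr mulr0 subr0.
have ljm : (j < m)%N by rewrite ltn_neqAle jm -ltnS ltn_ord.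
rewrite (bigD1 (Ordinal ljm)) //= eqxx big1 => [|a aj]; last first.
  case: eqP => [ja|_]; last by rewrite mulr0.
  by case/eqP: aj; apply: val_inj.
by rewrite mxE mulr1 mulr0 !subr0 mulr1 addr0.
Qed.

Lemma sum_nu : \sum_(i < n) nu F i = 0.
Proof.
apply/rowP=> a; rewrite summxE mxE; under eq_bigr do rewrite mxE.
rewrite sumrB; case: n a => [[]//|m] a /=.
rewrite (bigD1 (widen_ord (leqnSn m) a)) //= eqxx big1 => [|i ia]; last first.
  by case: eqP => // e; case/eqP: ia; apply: val_inj.
rewrite (bigD1 ord_max) //= eqxx big1 => [|i im]; last first.
  by case: eqP => // e; case/eqP: im; apply: val_inj.
by rewrite subrr.
Qed.

Lemma inS_is_linear : linear (@inS F n).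
Proof.
move=> c x y; rewrite /inS scaler_sumr -big_split; apply: eq_bigr => j _ /=.
by rewrite !mxE scalerDl scalerA.
Qed.

Lemma inB_is_zmod_morphism : zmod_morphism (@inB F n).
Proof.
move=> x y; rewrite /inB -tofracB; congr (_%:F).
by rewrite addrC -scaleN1r inS_is_linear scaleN1r addrC.
Qed.

Lemma form_is_linear (x : hdual F n) : linear_for *%R (form x).
Proof. by move=> c y z; rewrite /form linearP mulmxDr -scalemxAr !mxE. Qed.

HB.instance Definition _ x :=
  GRing.isLinear.Build F (hdual F n) F *%R (form x) (form_is_linear x).

Lemma formDl (x y z : hdual F n) : form (x + y) z = form x z + form y z.
Proof. by rewrite /form !mulmxDl mxE. Qed.

Lemma form0l (x : hdual F n) : form 0 x = 0.
Proof. by rewrite /form !mul0mx mxE. Qed.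

Lemma twistS_inS (lam x : hdual F n) :
  twistS lam (inS x) = inS x + (form lam x)%:MP.
Proof.
rewrite [in LHS]/inS /twistS linear_sum /=.
under eq_bigr do
  rewrite linearZ /= comp_mpolyXU -tnth_nth tnth_mktuple scalerDr.
rewrite big_split; congr (_ + _); rewrite [in RHS](row_sum_delta x).
rewrite linear_sum rmorph_sum; apply: eq_bigr => j _ /=.
by rewrite linearZ /= -mul_mpolyC -mpolyCM.
Qed.

Lemma twistSD (lam mu : hdual F n) p :
  twistS (lam + mu) p = twistS lam (twistS mu p).
Proof.
rewrite (mpolyE p) [LHS]linear_sum [twistS mu _]linear_sum [RHS]linear_sum.
apply: eq_bigr => m _ /=.
rewrite [in RHS]linearZ [in RHS]linearZ [LHS]linearZ /=.
congr (_ *: _); rewrite [LHS]comp_mpolyX [twistS mu _]comp_mpolyX.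
rewrite (rmorph_prod (twistS lam)); apply: eq_bigr => j _.
rewrite (rmorphXn (twistS lam)) !tnth_mktuple (rmorphD (twistS lam)) /=.
congr (_ ^+ _); rewrite [twistS lam 'X_j]comp_mpolyXU.
rewrite [twistS lam _%:MP]comp_mpolyC -tnth_nth tnth_mktuple.
by rewrite formDl mpolyCD addrA.
Qed.

Lemma twistS0 p : @twistS F n 0 p = p.
Proof.
rewrite /twistS -[RHS]comp_mpoly_id; congr (_ \mPo _).
by apply: eq_from_tnth => j; rewrite !tnth_mktuple form0l mpolyC0 addr0.
Qed.

Lemma twistS_inj (lam : hdual F n) : injective (twistS lam).
Proof.
apply: (can_inj (g := twistS (- lam))) => p.
by rewrite -twistSD addNr twistS0.
Qed.

HB.instance Definition _ lam :=
  GRing.isZmodMorphism.Build _ _ (twist lam) (frac_mapB (@twistS_inj lam)).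
HB.instance Definition _ lam :=
  GRing.isMonoidMorphism.Build _ _ (twist lam) (frac_mapM (@twistS_inj lam)).

Lemma twist_tofrac (lam : hdual F n) p : twist lam p%:F = (twistS lam p)%:F.
Proof. exact/frac_map_tofrac/twistS_inj. Qed.

Lemma twistD (lam mu : hdual F n) b :
  twist (lam + mu) b = twist lam (twist mu b).
Proof.
rewrite (frac_numden b); move: (\n_ _) (\d_ _) => a d.
rewrite [twist mu _]fmorph_div [LHS]fmorph_div [RHS]fmorph_div /=.
by rewrite !twist_tofrac !twistSD.
Qed.

Lemma twist0 b : @twist F n 0 b = b.
Proof.
rewrite (frac_numden b); move: (\n_ _) (\d_ _) => a d.
by rewrite fmorph_div /= !twist_tofrac !twistS0.
Qed.

Lemma twist_inB (lam x : hdual F n) :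
  twist lam (inB x) = inB x + (form lam x)%:MP%:F.
Proof. by rewrite twist_tofrac twistS_inS tofracD. Qed.

End WeightsTheory.

(* A linear operator U -> W (x) B is given by the matrix over B whose i-th
   column lists the components of the image of the i-th basis vector of U.
   Composition (with B-linear extension) is then the matrix product [*m], and
   inversion is [invmx]. The basis vector e_i (x) e_j of a tensor product has
   index [mxtens_index (i, j)]. *)
Section Operators.
Variables (F : closedFieldType) (n : nat).

(* The twisted tensor product of f : V -> V' (x) B and g : W -> W' (x) B, where
   the b-th basis vector of W' has weight [wt b]. *)
Definition ttens p p' q q' (wt : 'I_q' -> hdual F n)
    (f : 'M[fracB F n]_(p', p)) (g : 'M[fracB F n]_(q', q)) :
    'M[fracB F n]_(p' * q', p * q) :=
  \matrix_(x, y)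
    let: (a, b) := mxtens_unindex x in let: (i, j) := mxtens_unindex y in
    twist (wt b) (f a i) * g b j.

Definition left_op (A : 'M[fracB F n]_n) : 'M[fracB F n]_(n * n) :=
  ttens (@nu F n) A 1%:M.

Definition right_op (A : 'M[fracB F n]_n) : 'M[fracB F n]_(n * n) :=
  ttens (@nu F n) 1%:M A.

Definition gauge (R : 'M[fracB F n]_(n * n)) (A : 'M[fracB F n]_n) :
    'M[fracB F n]_(n * n) :=
  invmx (right_op A) *m invmx (left_op A) *m R *m left_op A *m right_op A.

(* Indices start at 0, whence the exponent [i] instead of [i - 1]. *)
Definition Aop : 'M[fracB F n]_n := \matrix_(k, i) nuB F k ^+ i.

Definition dynR : 'M[fracB F n]_(n * n) :=
  \matrix_(x, y)
    let: (i, j) := mxtens_unindex y in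
    (mxtens_unindex x == (i, j))%:R
      * (nuB F i - nuB F j + (i == j)%:R)^-1
    + (mxtens_unindex x == (j, i))%:R
      * (1 - (nuB F j - nuB F i + (i == j)%:R)^-1).

End Operators.

(* Polynomials in z_1, z_2: z_1 is the outer variable ['X], z_2 the inner
   variable ['Y]. *)
Section PolynomialOperators.
Variable F : closedFieldType.
Implicit Types f : {poly {poly F}}.

Definition shiftop (h : F) f : {poly {poly F}} :=
  map_poly (comp_poly ('X - h%:P)) f \Po ('X + h%:P%:P).

(* The division is exact, see [opR_div]. *)
Definition opR (n : nat) (h : F) f : {poly {poly F}} :=
  shiftop h f
  - (h * n%:R)%:P%:P
    * ((shiftop h f - swapXY f) %/ ('X - 'Y + h%:P%:P)).

Definition opRt (n : nat) f : {poly {poly F}} := opR n n%:R^-1 (swapXY f).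

(* The restriction of [opRt n] to the span of z_1^i z_2^j with i, j < n, which
   is stable, see [opRt_stable]. *)
Definition Rtilde (n : nat) : 'M[fracB F n]_(n * n) :=
  \matrix_(x, y)
    let: (k, l) := mxtens_unindex x in let: (i, j) := mxtens_unindex y in
    ((opRt n ('X^i * 'Y ^+ j))`_k`_l)%:MP%:F.

End PolynomialOperators.


Section OperatorsTheory.
Variables (F : closedFieldType) (n : nat).
Local Notation B := (fracB F n).

Lemma mxtens_index_bij m p : bijective (@mxtens_index m p).
Proof.
by exists mxtens_unindex; [exact: mxtens_indexK | exact: mxtens_unindexK].
Qed.

Lemma mulmx_tens (f g : 'M[B]_(n * n)) k l i j :
  (f *m g) (mxtens_index (k, l)) (mxtens_index (i, j)) =
  \sum_a \sum_b f (mxtens_index (k, l)) (mxtens_index (a, b)) *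
                  g (mxtens_index (a, b)) (mxtens_index (i, j)).
Proof.
rewrite mxE pair_bigA (reindex mxtens_index) /=.
  by apply: eq_bigr => -[a b] _.
apply: onW_bij; exact: mxtens_index_bij.
Qed.

Lemma left_opE (f : 'M[B]_n) k l i j :
  left_op f (mxtens_index (k, l)) (mxtens_index (i, j)) =
  twist (nu F l) (f k i) * (l == j)%:R.
Proof. by rewrite mxE !mxtens_indexK !mxE. Qed.

Lemma right_opE (f : 'M[B]_n) k l i j :
  right_op f (mxtens_index (k, l)) (mxtens_index (i, j)) =
  (k == i)%:R * f l j.
Proof. by rewrite mxE !mxtens_indexK !mxE /= rmorph_nat. Qed.

Lemma left_opM (f g : 'M[B]_n) : left_op (f *m g) = left_op f *m left_op g.
Proof.
apply/matrixP=> x y; case: (mxtens_indexP x) => k l.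
case: (mxtens_indexP y) => i j; rewrite mulmx_tens left_opE mxE.
rewrite rmorph_sum mulr_suml; apply: eq_bigr => a _.
rewrite (bigD1 l) //= big1 => [|b bl]; rewrite !left_opE.
  by rewrite eqxx mulr1 addr0 rmorphM mulrA.
by rewrite eq_sym (negPf bl) mulr0 mul0r.
Qed.

Lemma right_opM (f g : 'M[B]_n) : right_op (f *m g) = right_op f *m right_op g.
Proof.
apply/matrixP=> x y; case: (mxtens_indexP x) => k l.
case: (mxtens_indexP y) => i j; rewrite mulmx_tens right_opE mxE mulr_sumr.
rewrite [RHS](bigD1 k) //= [X in _ + X]big1 => [|a ak]; last first.
  by rewrite big1 // => b _; rewrite !right_opE eq_sym (negPf ak) !mul0r.
rewrite addr0; apply: eq_bigr => b _.
by rewrite !right_opE eqxx mul1r mulrCA.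
Qed.

Lemma left_op1 : left_op (1%:M : 'M[B]_n) = 1%:M.
Proof.
apply/matrixP=> x y; case: (mxtens_indexP x) => k l.
case: (mxtens_indexP y) => i j; rewrite left_opE !mxE rmorph_nat -natrM mulnb.
by rewrite (can_eq (@mxtens_indexK n n)).
Qed.

Lemma right_op1 : right_op (1%:M : 'M[B]_n) = 1%:M.
Proof. exact: left_op1. Qed.

Lemma nuB_inj : n%:R != 0 :> F -> injective (@nuB F n).
Proof.
move=> n0 i j eq_nu; have := congr1 (twist (nu F i)) eq_nu.
rewrite /nuB !twist_inB [inB (nu F i)]eq_nu => /addrI/eqP.
rewrite tofrac_eq mpolyC_eq !form_nu // => /eqP/addIr/eqP.
case: (eqVneq i j) => [//|_]; rewrite eqxx.
by rewrite oner_eq0.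
Qed.

Lemma Aop_unit : n%:R != 0 :> F -> Aop F n \in unitmx.
Proof.
move=> n0; rewrite -unitmx_tr.
have -> : (Aop F n)^T = Vandermonde n (\row_j nuB F j).
  by apply/matrixP=> i j; rewrite !mxE.
rewrite unitmxE det_Vandermonde unitfE; apply/prodf_neq0 => i _.
apply/prodf_neq0 => j ij; rewrite !mxE subr_eq0.
by apply: contraTneq ij => /(nuB_inj n0) ->; rewrite ltnn.
Qed.

Lemma left_op_unit (A : 'M[B]_n) : A \in unitmx -> left_op A \in unitmx.
Proof.
move=> uA; have e : left_op A *m left_op (invmx A) = 1%:M.
  by rewrite -left_opM mulmxV // left_op1.
exact: proj1 (mulmx1_unit e).
Qed.

Lemma right_op_unit (A : 'M[B]_n) : A \in unitmx -> right_op A \in unitmx.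
Proof.
move=> uA; have e : right_op A *m right_op (invmx A) = 1%:M.
  by rewrite -right_opM mulmxV // right_op1.
exact: proj1 (mulmx1_unit e).
Qed.

End OperatorsTheory.

Section PolynomialOperatorsTheory.
Variable F : closedFieldType.
Implicit Types f : {poly {poly F}}.

Lemma zdivE (h : F) :
  'X - 'Y + h%:P%:P = 'X - ('X - h%:P)%:P :> {poly {poly F}}.
Proof. by rewrite [in RHS]polyCB opprB addrA addrAC. Qed.

Lemma swapXY_horner f (p : {poly F}) :
  (swapXY f).[p] = (map_poly (comp_poly p) f).['X].
Proof.
elim/poly_ind: f => [|f c IHf]; first by rewrite !rmorph0 !horner0.
rewrite !rmorphD !rmorphM /= swapXY_X swapXY_polyC map_polyX map_polyC /=.
by rewrite !hornerE IHf.
Qed.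

Lemma opR_div (h : F) f :
  (shiftop h f - swapXY f) %/ ('X - 'Y + h%:P%:P) * ('X - 'Y + h%:P%:P)
  = shiftop h f - swapXY f.
Proof.
rewrite zdivE; set d := 'X - _%:P.
have md : d \is monic by exact: monicXsubC.
have : d %| shiftop h f - swapXY f; last first.
  by rewrite (Pdiv.IdomainMonic.dvdp_eq md) => /eqP <-.
rewrite dvdp_XsubCl /root hornerD hornerN subr_eq0 /shiftop horner_comp.
by rewrite !hornerE subrK swapXY_horner.
Qed.

Lemma size_shiftop (h : F) f : (size (shiftop h f) <= size f)%N.
Proof.
by rewrite /shiftop size_comp_poly2 ?size_XaddC // size_poly.
Qed.

HB.instance Definition _ (h : F) := GRing.RMorphism.copy (shiftop h)
  (comp_poly ('X + h%:P%:P) \o map_poly (comp_poly ('X - h%:P))).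

Lemma shiftop_X (h : F) : shiftop h 'X = 'X + h%:P%:P.
Proof. by rewrite /shiftop map_polyX comp_polyX. Qed.

Lemma shiftop_polyC (h : F) p : shiftop h p%:P = (p \Po ('X - h%:P))%:P.
Proof. by rewrite /shiftop map_polyC comp_polyC. Qed.

Lemma shiftop_Y (h : F) : shiftop h 'Y = 'Y - h%:P%:P.
Proof. by rewrite shiftop_polyC comp_polyX polyCB. Qed.

Lemma shiftop_swapXY (h : F) f :
  swapXY (shiftop h f) = shiftop (- h) (swapXY f).
Proof.
elim/poly_ind: f => [|f p IHf]; first by rewrite !rmorph0.
rewrite !rmorphD !rmorphM /= IHf shiftop_X swapXY_X shiftop_Y.
rewrite rmorphD /= swapXY_X swapXY_polyC map_polyC /= !polyCN opprK.
congr (_ + _); rewrite shiftop_polyC !swapXY_polyC.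
elim/poly_ind: p => [|p c IHp]; first by rewrite comp_poly0 !rmorph0.
rewrite comp_polyD comp_polyM comp_polyX comp_polyC !rmorphD !rmorphM /= IHp.
rewrite map_polyX shiftop_X !map_polyC /= shiftop_polyC comp_polyC.
by rewrite rmorphB /= map_polyX map_polyC /= !polyCN.
Qed.

Lemma sizeY_shiftop (h : F) f : (sizeY (shiftop h f) <= sizeY f)%N.
Proof. by rewrite !sizeYE shiftop_swapXY size_shiftop. Qed.

Lemma size_opR (n : nat) (h : F) f :
  (size f <= n)%N -> (sizeY f <= n)%N -> (size (opR n h f) <= n)%N.
Proof.
move=> sX sY; rewrite /opR.
have ss : (size (shiftop h f - swapXY f)%R <= n)%N.
  rewrite (leq_trans (size_polyD _ _)) // size_polyN geq_max -sizeYE sY andbT.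
  exact: leq_trans (size_shiftop h f) sX.
rewrite (leq_trans (size_polyD _ _)) // size_polyN geq_max.
rewrite (leq_trans (size_shiftop h f)) //= mul_polyC.
rewrite (leq_trans (size_scale_leq _ _)) // (leq_trans _ ss) //.
exact: leq_divp.
Qed.

Lemma sizeY_opR (n : nat) (h : F) f :
  (size f <= n)%N -> (sizeY f <= n)%N -> (sizeY (opR n h f) <= n)%N.
Proof.
move=> sX sY; rewrite /opR; set q := (_ %/ _).
have := opR_div h f; rewrite -/q => /(congr1 (@swapXY F)).
rewrite rmorphM rmorphB /= swapXYK => eq_q.
have sh : (size (swapXY (shiftop h f)) <= n)%N.
  by rewrite -sizeYE (leq_trans (sizeY_shiftop h f)).
have ss : (size (swapXY (shiftop h f) - f)%R <= n)%N.
  by rewrite (leq_trans (size_polyD _ _)) // size_polyN geq_max sX sh.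
have sq : (size (swapXY q) <= n)%N.
  have d0 : swapXY ('X - 'Y + h%:P%:P) != 0.
    by rewrite swapXY_eq0 zdivE polyXsubC_eq0.
  have [->|q0] := eqVneq (swapXY q) 0; first by rewrite size_poly0.
  rewrite (leq_trans _ ss) // -eq_q size_mul //.
  by rewrite -subn1 -addnBA ?leq_addr // lt0n size_poly_eq0.
rewrite sizeYE rmorphB rmorphM /= (leq_trans (size_polyD _ _)) //.
rewrite size_polyN geq_max sh /= swapXY_polyC map_polyC /= mul_polyC.
exact: leq_trans (size_scale_leq _ _) sq.
Qed.

Lemma opRt_stable (n : nat) f : (size f <= n)%N -> (sizeY f <= n)%N ->
  (size (opRt n f) <= n)%N /\ (sizeY (opRt n f) <= n)%N.
Proof.
move=> sX sY; split; [apply: size_opR | apply: sizeY_opR];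
  by rewrite ?sizeYE ?swapXYK // -sizeYE.
Qed.

End PolynomialOperatorsTheory.

(* Main.v *)
(* In the polynomial model the column (i, j) of A_1 A_2 lists the values of
   z_1^i z_2^j at the points (nu_k^{nu_l}, nu_l). Hence A_1 A_2 Rtilde lists the
   values of Rtilde (z_1^i z_2^j) at these points, where the denominator
   z_1 - z_2 + 1/n takes the value nu_k - nu_l + delta_kl, exactly the one in
   the dynamical R-matrix; comparing with R A_1 A_2 is then immediate. *)
From HB Require Import structures.
Require Import Defs.
From mathcomp Require Import all_boot all_algebra.
From mathcomp Require Import fraction polyXY mxtens mpoly ring.

Import GRing.Theory.
Local Open Scope ring_scope.

(** With the inverses moved across, the gauge identity becomes an intertwining relation, so neither
    inverse has to be computed. *)
Lemma conj_mulmx_eq (K : comUnitRingType) (m : nat) (P Q D S : 'M[K]_m) :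
  P \in unitmx -> Q \in unitmx -> D *m (P *m Q) = P *m Q *m S ->
  invmx Q *m invmx P *m D *m P *m Q = S.
Proof.
move=> uP uQ eqD.
by rewrite -!mulmxA eqD -mulmxA (mulKmx uP) (mulKmx uQ).
Qed.

Section BivariateEvaluation.
Set Implicit Arguments.
Unset Strict Implicit.
Variables (F : closedFieldType) (L : fieldType) (c : {rmorphism F -> L}).
Implicit Types (x y : L) (f : {poly {poly F}}).

(** Written as a composite of ring morphisms, sending z_1 to [x] and z_2 to [y], so that it inherits
    a morphism structure. *)
Definition eval2 x y : {poly {poly F}} -> L :=
  horner_eval x \o map_poly (horner_eval y \o map_poly c).

HB.instance Definition _ x y := GRing.RMorphism.copy (eval2 x y)
  (horner_eval x \o map_poly (horner_eval y \o map_poly c)).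

Lemma eval2_X x y : eval2 x y 'X = x.
Proof. by rewrite /eval2 /= map_polyX /horner_eval hornerX. Qed.

Lemma eval2_polyC x y p : eval2 x y p%:P = (map_poly c p).[y].
Proof. by rewrite /eval2 /= map_polyC /horner_eval hornerC. Qed.

Lemma eval2_const x y a : eval2 x y a%:P%:P = c a.
Proof. by rewrite eval2_polyC map_polyC hornerC. Qed.

Lemma eval2_Y x y : eval2 x y 'Y = y.
Proof. by rewrite eval2_polyC map_polyX hornerX. Qed.

Lemma eval2_swapXY x y f : eval2 x y (swapXY f) = eval2 y x f.
Proof.
elim/poly_ind: f => [|f p IHf]; first by rewrite !rmorph0.
rewrite !rmorphD !rmorphM /= IHf swapXY_X eval2_X eval2_Y; congr (_ + _).
rewrite swapXY_polyC eval2_polyC.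
elim/poly_ind: p => [|p a IHp]; first by rewrite !rmorph0 horner0.
rewrite !rmorphD !rmorphM /= IHp !map_polyX !map_polyC eval2_X eval2_const /=.
by rewrite !hornerE.
Qed.

Lemma eval2_shiftop (h : F) x y f :
  eval2 x y (shiftop h f) = eval2 (x + c h) (y - c h) f.
Proof.
elim/poly_ind: f => [|f p IHf]; first by rewrite !rmorph0.
rewrite !rmorphD !rmorphM /= IHf shiftop_X shiftop_polyC rmorphD /=.
rewrite !eval2_X eval2_const !eval2_polyC map_comp_poly horner_comp.
by rewrite rmorphB /= map_polyX map_polyC !hornerE.
Qed.

(** The quotient in [opR] is exact, so evaluating [opR_div] and dividing by the nonzero value of the
    divisor gives the value of the quotient. *)
Lemma eval2_opR (n : nat) (h : F) x y f : x - y + c h != 0 ->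
  eval2 x y (opR n h f) =
  eval2 (x + c h) (y - c h) f
  - c (h * n%:R) * ((eval2 (x + c h) (y - c h) f - eval2 y x f) /
                    (x - y + c h)).
Proof.
move=> d0; have := congr1 (eval2 x y) (opR_div h f).
rewrite /opR; set q := _ %/ _; set d := 'X - 'Y + _.
have dE : eval2 x y d = x - y + c h.
  by rewrite rmorphD rmorphB /= eval2_X eval2_Y eval2_const.
rewrite !(rmorphM (eval2 x y)) !(rmorphB (eval2 x y)) !(rmorphM (eval2 x y)).
by rewrite /= dE eval2_shiftop eval2_swapXY eval2_const => <-; rewrite mulfK.
Qed.

Lemma eval2E (n : nat) x y f : (size f <= n)%N -> (sizeY f <= n)%N ->
  eval2 x y f = \sum_(k < n) \sum_(l < n) c f`_k`_l * (x ^+ k * y ^+ l).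
Proof.
move=> sX sY; rewrite -[LHS]/(map_poly (horner_eval y \o map_poly c) f).[x].
rewrite (horner_coef_wide _ (leq_trans (size_poly _ _) sX)).
apply: eq_bigr => k _; rewrite coef_map /= /horner_eval.
have sk : (size (map_poly c f`_k) <= n)%N.
  exact: leq_trans (size_poly _ _) (leq_trans (max_size_coefXY _ _) sY).
rewrite (horner_coef_wide _ sk) mulr_suml; apply: eq_bigr => l _.
by rewrite coef_map /= mulrAC mulrA.
Qed.

End BivariateEvaluation.

Section Gauge.
Variables (F : closedFieldType) (n : nat).
Hypothesis n0 : n%:R != 0 :> F.
Local Notation nuB := (@nuB F n).

Definition constB : {rmorphism F -> fracB F n} :=
  @FracField.tofrac (symh F n) \o @mpolyC n.-1 F.

(** The element nu_k^{nu_l} of B, by (nu_l, nu_k) = delta_kl - 1/n. *)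
Definition twisted_nuB (k l : 'I_n) : fracB F n :=
  nuB k + (k == l)%:R - constB n%:R^-1.

Lemma twist_nuB (k l : 'I_n) : twist (nu F l) (nuB k) = twisted_nuB k l.
Proof.
rewrite /Defs.nuB twist_inB form_nu // eq_sym /twisted_nuB -addrA; congr (_ + _).
by rewrite -[LHS]/(constB _) rmorphB rmorph_nat.
Qed.

Lemma left_right_AopE (k l i j : 'I_n) :
  (left_op (Aop F n) *m right_op (Aop F n))
    (mxtens_index (k, l)) (mxtens_index (i, j)) =
  twisted_nuB k l ^+ i * nuB l ^+ j.
Proof.
(* [right_op] keeps the first index and [left_op] the second, so only the intermediate pair (i, l)
   contributes. *)
rewrite mulmx_tens (bigD1 i) //= [X in _ + X]big1 => [|a ai]; last first.
  by rewrite big1 // => b _; rewrite right_opE (negPf ai) mul0r mulr0.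
rewrite addr0 (bigD1 l) //= big1 => [|b bl]; last first.
  by rewrite left_opE eq_sym (negPf bl) mulr0 mul0r.
rewrite addr0 left_opE right_opE !eqxx mulr1 mul1r !mxE.
by rewrite rmorphXn /= twist_nuB.
Qed.

Lemma nuB_diff_neq0 (k l : 'I_n) : nuB k - nuB l + (k == l)%:R != 0.
Proof.
have [->|kl] := eqVneq k l; first by rewrite subrr add0r oner_neq0.
by rewrite addr0 subr_eq0 (inj_eq (nuB_inj n0)).
Qed.

(** Row (k, l) of [dynR] is supported on the columns (k, l) and (l, k). For k = l both terms sit on
    one entry, and [alpha] is 1. *)
Lemma dynR_mulE (M : 'M[fracB F n]_(n * n)) (k l i j : 'I_n) :
  let alpha := (nuB k - nuB l + (k == l)%:R)^-1 in
  (dynR F n *m M) (mxtens_index (k, l)) (mxtens_index (i, j)) =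
  alpha * M (mxtens_index (k, l)) (mxtens_index (i, j))
  + (1 - alpha) * M (mxtens_index (l, k)) (mxtens_index (i, j)).
Proof.
move=> alpha; rewrite mulmx_tens pair_bigA /=.
under eq_bigr do rewrite mxE !mxtens_indexK /= mulrDl -!mulrA.
rewrite big_split /=; congr (_ + _).
  rewrite (bigD1 (k, l)) //= big1 => [|[a b] ab].
    by rewrite eqxx mul1r addr0.
  by rewrite eq_sym (negPf ab) mul0r.
rewrite (bigD1 (l, k)) //= big1 => [|[a b] ab].
  by rewrite eqxx mul1r addr0 [l == k]eq_sym.
suff /negPf -> : (k, l) != (b, a) by rewrite mul0r.
by apply: contra ab; rewrite !xpair_eqE andbC eq_sym (eq_sym k).
Qed.

(** By [opRt_stable], [Rtilde] records every coefficient, so pairing them with the monomial values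
    in a row of A_1 A_2 evaluates the whole polynomial. *)
Lemma left_right_Aop_RtildeE (k l i j : 'I_n) :
  (left_op (Aop F n) *m right_op (Aop F n) *m Rtilde F n)
    (mxtens_index (k, l)) (mxtens_index (i, j)) =
  eval2 constB (twisted_nuB k l) (nuB l) (opRt n ('X^i * 'Y ^+ j)).
Proof.
set f : {poly {poly F}} := 'X^i * _.
have fE : f = 'X^i * ('X^j)%:P by rewrite /f rmorphXn.
have sX : (size f <= n)%N.
  by rewrite fE mulrC mul_polyC (leq_trans (size_scale_leq _ _)) ?size_polyXn.
have sY : (sizeY f <= n)%N.
  rewrite sizeYE fE rmorphM /= swapXY_polyC rmorphXn /= swapXY_X map_polyXn.
  by rewrite -rmorphXn mul_polyC (leq_trans (size_scale_leq _ _)) ?size_polyXn.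
have [sX' sY'] := opRt_stable sX sY.
rewrite (eval2E _ _ _ sX' sY') mulmx_tens.
apply: eq_bigr => a _; apply: eq_bigr => b _.
by rewrite left_right_AopE [Rtilde F n _ _]mxE !mxtens_indexK mulrC.
Qed.

Lemma dynR_left_right_Aop :
  dynR F n *m (left_op (Aop F n) *m right_op (Aop F n)) =
  left_op (Aop F n) *m right_op (Aop F n) *m Rtilde F n.
Proof.
apply/matrixP=> x y; case: (mxtens_indexP x) => k l.
case: (mxtens_indexP y) => i j.
rewrite dynR_mulE left_right_Aop_RtildeE !left_right_AopE.
have dE : twisted_nuB k l - nuB l + constB n%:R^-1 =
          nuB k - nuB l + (k == l)%:R by rewrite /twisted_nuB; ring.
have d0 := nuB_diff_neq0 k l.
(* For h = 1/n the factor h n is 1, which leaves 1 - [alpha] on the shifted term and [alpha] on the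
   term where the two swaps cancel. *)
rewrite /opRt eval2_opR dE // mulVf // rmorph1 mul1r !eval2_swapXY.
rewrite !rmorphM !rmorphXn /= !eval2_X !eval2_Y.
(* The shift moves the point to (nu_k + delta_kl, nu_l - 1/n); for distinct k and l this is the
   point of row (l, k) with its coordinates exchanged. *)
have -> : twisted_nuB k l + constB n%:R^-1 = nuB k + (k == l)%:R.
  by rewrite /twisted_nuB subrK.
move: d0; rewrite /twisted_nuB [l == k]eq_sym.
(* On the diagonal the coefficient of the swapped term vanishes. *)
case: (eqVneq k l) => [->|_] d0; first by rewrite subrr add0r invr1; ring.
by rewrite !addr0; ring.
Qed.

End Gauge.

Theorem theorem3p1 (F : closedFieldType) (charF0 : [pchar F] =i pred0)
    (n : nat) (n_ge2 : (2 <= n)%N) :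
  gauge (dynR F n) (Aop F n) = Rtilde F n.
Proof.
(* Characteristic zero makes n nonzero in [F], so the nu_k are distinct and the Vandermonde matrix
   [Aop] is invertible. *)
have n0 : n%:R != 0 :> F by rewrite ((pcharf0P F).1 charF0) -lt0n ltnW.
have uA := Aop_unit n0.
apply: conj_mulmx_eq; [exact: left_op_unit | exact: right_op_unit |].
exact: dynR_left_right_Aop.
Qed.
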